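(* Let $d\ge 1$ be an integer, and let $\alpha\in(0,1)$ if $d=1$, respectively $\alpha>0$ if $d>1$. Let $J:\mathbb{Z}^d\times\mathbb{Z}^d\to[0,\infty)$ be a symmetric, translation invariant and integrable kernel such that, for some constant $C_1<\infty$, $J(x,y)\le C_1\|x-y\|^{-d-\alpha}$ for all $x\neq y$ in $\mathbb{Z}^d$. Assume that $\beta_c<\infty$, and that the exponent $2-\eta$ exists, i.e. there is a real number $2-\eta$ such that $$\mathbb{P}_{\beta_c}(0\leftrightarrow x)=\|x\|^{-d+2-\eta+o(1)}\qquad\text{as } \|x\|\to\infty .$$ Then $$2-\eta\ \ge\ \alpha\wedge 1 .$$
   Context: Long-range percolation on $\mathbb{Z}^d$: for a kernel $J:\mathbb{Z}^d\times\mathbb{Z}^d\to[0,\infty)$ that is symmetric ($J(x,y)=J(y,x)$), translation invariant ($J(x,y)=J(0,y-x)$) and integrable ($\sum_{x\in\mathbb{Z}^d}J(0,x)<\infty$), and a parameter $\beta\ge 0$, each unordered pair $\{x,y\}$ of distinct vertices of $\mathbb{Z}^d$ is declared an open edge with probability $1-e^{-\beta J(x,y)}$, independently of all other pairs. $\mathbb{P}_\beta$ denotes the resulting probability measure. $K_0$ is the connected component (cluster) of the origin $0$ in the graph of open edges, and $0\leftrightarrow x$ is the event that there is a path of open edges from $0$ to $x$. The critical parameter is $\beta_c=\inf\{\beta\ge 0:\mathbb{P}_\beta(|K_0|=\infty)>0\}$. $\|\cdot\|$ is a fixed norm on $\mathbb{R}^d$, and $a\wedge b=\min\{a,b\}$.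 *)

(* Defs.v *)
From HB Require Import structures.
From mathcomp Require Import all_boot all_order all_algebra finmap.
From mathcomp Require Import all_classical all_reals all_analysis.

Set Implicit Arguments.
Unset Strict Implicit.
Unset Printing Implicit Defensive.

Import Order.TTheory GRing.Theory Num.Theory.
Import numFieldNormedType.Exports.

Local Open Scope fset_scope.
Local Open Scope classical_set_scope.
Local Open Scope ring_scope.

Definition site (d : nat) := 'rV[int]_d.

Record is_norm (R : realType) (d : nat) (nrm : 'rV[R]_d -> R) : Prop := {
  is_norm_triangle : forall u v, nrm (u + v) <= nrm u + nrm v;
  is_norm_scale : forall a u, nrm (a *: u) = `|a| * nrm u;
  is_norm_definite : forall u, nrm u = 0 -> u = 0 }.

Definition site_norm (R : realType) (d : nat) (nrm : 'rV[R]_d -> R)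
  (x : site d) : R := nrm (map_mx intr x).

(* The neighbourhoods of infinity in Z^d, for the limit ||x|| -> oo. *)
Definition at_infinity (R : realType) (d : nat) (nrm : 'rV[R]_d -> R) :
    set_system (site d) :=
  filter_from setT (fun M : R => [set x | M < site_norm nrm x]).

Global Instance at_infinity_filter (R : realType) (d : nat)
  (nrm : 'rV[R]_d -> R) : Filter (at_infinity nrm).
Proof.
apply: filter_from_filter; first by exists 0.
move=> M N _ _; exists (Num.max M N) => // x /=.
by rewrite gt_max => /andP[].
Qed.

Record percolation_kernel (R : realType) (d : nat)
    (J : site d -> site d -> R) : Prop := {
  kernel_ge0 : forall x y, 0 <= J x y;
  kernel_sym : forall x y, J x y = J y x;
  kernel_translation : forall x y, J x y = J 0 (y - x);
  kernel_integrable : (\esum_(x in [set: site d]) (J 0 x)%:E < +oo)%E }.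

(* Unordered pairs of distinct sites. *)
Definition edge (d : nat) := {e : {fset site d} | #|` e| == 2}.

Definition cylinders (d : nat) : set (set (edge d -> bool)) :=
  [set [set w : edge d -> bool | w e] | e in [set: edge d]].

(* Configurations w, where w e = true means that e is open, with the product
   sigma-algebra. *)
Definition config (d : nat) := g_sigma_algebraType (@cylinders d).

(* [insub] is None exactly when x = y. *)
Definition open_edge (d : nat) (w : config d) : rel (site d) :=
  fun x y => oapp w false (insub [fset x; y]).

Definition connected_in (d : nat) (w : config d) (x y : site d) : Prop :=
  exists p : seq (site d), path (open_edge w) x p /\ last x p = y.

Definition cluster (d : nat) (w : config d) (x : site d) : set (site d) :=
  [set y | connected_in w x y].

Definition independent_events (disp : measure_display)
    (T : measurableType disp) (R : realType) (P : probability T R)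
    (I : choiceType) (E : I -> set T) : Prop :=
  forall A : {fset I},
    P (\bigcap_(i in [set` A]) E i) = (\prod_(i <- A) P (E i))%E.

(* By the pi-lambda theorem these two conditions characterise P_beta. *)
Record percolation_law (R : realType) (d : nat) (J : site d -> site d -> R)
    (beta : R) (P : probability (config d) R) : Prop := {
  law_marginal : forall x y : site d, x != y ->
    P [set w | open_edge w x y] = (1 - expR (- (beta * J x y)))%:E;
  law_independent :
    independent_events P (fun e : edge d => [set w : config d | w e]) }.

Definition beta_c (R : realType) (d : nat)
    (P : R -> probability (config d) R) : \bar R :=
  ereal_inf [set beta%:E | beta in
    [set beta : R | 0 <= beta /\
      (0 < P beta [set w : config d | infinite_set (cluster w 0%R)])%E]].

(* f x = ||x|| ^ (a + o(1)) as ||x|| -> oo. *)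
Definition decays_with_exponent (R : realType) (d : nat) (nrm : 'rV[R]_d -> R)
    (f : site d -> \bar R) (a : R) : Prop :=
  exists eps : site d -> R,
    eps x @[x --> at_infinity nrm] --> 0 /\
    \forall x \near at_infinity nrm,
      f x = (site_norm nrm x `^ (a + eps x))%:E.

(* Main.v *)
(* By the argument of Duminil-Copin and Tassion, at criticality
     1 <= beta_c * \sum_(u in S) P(0 <-> u in S) * \sum_(v notin S) J u v
   for every finite S containing 0: otherwise, by continuity, the same sum is below 1
   at some beta >= beta_c with an infinite cluster, while it being below 1 forces the
   expected cluster size to be finite.  Take for S the box of radius n in the sup norm,
   where \sum_(v notin S) J u v <= C * (n + 1 - |u|) ^ (- a) for all 0 < a <= alpha.
   If 2 - eta < s < a < min alpha 1, then summing over n < N gives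
     N <= C * (\sum_(|u| <= N) P(0 <-> u)) * \sum_(m <= N) m ^ (- a)
       <= C' * N ^ s * N ^ (1 - a),
   which fails for large N. *)

Require Import Defs.
From HB Require Import structures.
From mathcomp Require Import all_boot all_order all_algebra finmap.
From mathcomp Require Import all_classical all_reals all_analysis.
From mathcomp Require Import zify ring lra.

Set Implicit Arguments.
Unset Strict Implicit.
Unset Printing Implicit Defensive.

Import Order.TTheory GRing.Theory Num.Theory.
Import numFieldNormedType.Exports.

Local Open Scope fset_scope.
Local Open Scope classical_set_scope.
Local Open Scope ring_scope.

(** The law is given only by the probabilities of single edges and the product rule for
    intersections of open-edge events, and nothing relates the measures [P beta] at different
    [beta]. Probabilistic steps are therefore reduced to events that depend on finitely many edges:
    such a probability is an explicit polynomial in the edge probabilities, which gives continuity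
    in [beta] and translation invariance, and the same recursion gives independence over disjoint
    sets of edges.

    That the sum being below 1 bounds the expected cluster size is a fixed-point argument. With
    connections confined to a finite set [L], the expected number of sites of [L] reached from [z]
    is at most |L|, and its supremum over [z] satisfies sup <= |S| + psi * sup with psi < 1. The
    resulting bound does not depend on [L], so it survives the passage to Z^d, and Borel-Cantelli
    then excludes an infinite cluster.

    Sums of powers are estimated on dyadic shells, with a count of points up to radius 2k as the
    only input; the same estimates serve in Z^d and, with dimension 1, for the sum over m. *)

Lemma sum_seq_le_count (R : realType) (T : Type) (r : seq T) (A : pred T)
    (F : T -> R) (c : R) :
  (forall x, A x -> F x <= c) -> \sum_(x <- r | A x) F x <= c * (count A r)%:R.
Proof.
move=> Fc; apply: (@le_trans _ _ (\sum_(x <- r | A x) c)); first exact: ler_sum.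
by rewrite big_const_seq iter_addr addr0 mulr_natr.
Qed.

Lemma powRN_le (R : realType) (a b p : R) :
  0 < a -> a <= b -> 0 <= p -> b `^ (- p) <= a `^ (- p).
Proof.
move=> a0 ab p0; rewrite !powRN lef_pV2 ?posrE ?powR_gt0 //; last exact: lt_le_trans ab.
by apply: ge0_ler_powR => //; rewrite nnegrE ltW // (lt_le_trans a0).
Qed.

Lemma powR2_gt1 (R : realType) (s : R) : 0 < s -> 1 < 2 `^ s :> R.
Proof. by move=> s0; rewrite /powR pnatr_eq0 /= expR_gt1 mulr_gt0 // ln_gt0 // ltr1n. Qed.

Lemma powR2_lt1 (R : realType) (s : R) : s < 0 -> 2 `^ s < 1 :> R.
Proof.
move=> s0; rewrite -[s]opprK powRN invf_lt1 ?powR_gt0 //.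
by apply: powR2_gt1; rewrite oppr_gt0.
Qed.

Lemma sum_seq_cover (R : realType) (T : Type) (r : seq T) (A B C : pred T)
    (F : T -> R) :
  (forall x, 0 <= F x) -> (forall x, A x -> B x || C x) ->
  \sum_(x <- r | A x) F x <= \sum_(x <- r | B x) F x + \sum_(x <- r | C x) F x.
Proof.
move=> F0 ABC; rewrite [leLHS]big_mkcond [X in _ <= X + _]big_mkcond.
rewrite [X in _ <= _ + X]big_mkcond -big_split; apply: ler_sum => x _ /=.
by move: (F0 x) (ABC x); case: (A x); case: (B x); case: (C x) => //= F0x h;
  try lra; have := h isT.
Qed.

(** * Sums of powers under polynomial volume growth *)

Section DyadicSums.
Variables (R : realType) (T : eqType) (r : seq T) (h : T -> nat) (D : nat) (c : R).
Hypothesis count_h : forall k : nat, (0 < k)%N ->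
  (count (fun x => (h x <= 2 * k)%N) r)%:R <= c * k%:R ^+ D.

Let c_ge0 : 0 <= c.
Proof. by have := @count_h 1%N isT; rewrite expr1n mulr1; apply: le_trans. Qed.

Lemma shell_sum (k : nat) (p : R) : (0 < k)%N -> 0 <= p ->
  \sum_(x <- r | (k <= h x <= 2 * k)%N) (h x)%:R `^ (- p) <= c * k%:R `^ (D%:R - p).
Proof.
move=> k0 p0; have k0R : 0 < k%:R :> R by rewrite ltr0n.
apply: (@le_trans _ _ (k%:R `^ (- p) *
    (count (fun x => (k <= h x <= 2 * k)%N) r)%:R)).
  apply: sum_seq_le_count => x /andP[kh _].
  by apply: powRN_le => //; rewrite ler_nat.
rewrite powRD ?(gt_eqF k0R) ?implybT // mulrA mulrC powR_mulrn ?ler0n//.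
rewrite ler_wpM2r ?powR_ge0 //.
apply: le_trans (count_h k0).
by rewrite ler_nat; apply: sub_count => x /andP[].
Qed.

(** The shell from 2^j to 2^(j+1) contributes at most c * q^j with q = 2^s > 1, so the last shell
    dominates. The constant K = c * (1 + 1/(q - 1)) is at least c, which settles J = 0, and
    satisfies K + c <= K * q, which is the induction step. *)
Lemma dyadic_sum (s : R) (J : nat) : 0 < s -> s <= D%:R ->
  \sum_(x <- r | (1 <= h x <= 2 ^ J)%N) (h x)%:R `^ (s - D%:R)
    <= c * (1 + (2 `^ s - 1)^-1) * (2 `^ s) ^+ J.
Proof.
move=> s0 sD; set q := 2 `^ s; have q1 : 1 < q by exact: powR2_gt1.
set K := c * _; have qK : K + c * q ^+ 0 <= K * q.
  rewrite expr0 mulr1 /K -subr_ge0 [X in 0 <= X](_ : _ = c * (q - 1)); last by field; lra.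
  by rewrite mulr_ge0 //; lra.
rewrite -[s - _]opprB; have p0 : 0 <= D%:R - s by lra.
have shell j : \sum_(x <- r | (2 ^ j <= h x <= 2 * 2 ^ j)%N)
    (h x)%:R `^ (- (D%:R - s)) <= c * q ^+ j.
  apply: le_trans (shell_sum _ p0) _; first by rewrite expn_gt0.
  have -> : D%:R - (D%:R - s) = s by lra.
  by rewrite natrX -powR_mulrn // powRAC powR_mulrn ?powR_ge0.
elim: J => [|J IH].
  apply: (@le_trans _ _ (c * q ^+ 0)).
    apply: le_trans (shell 0%N); rewrite [leLHS]big_mkcond [leRHS]big_mkcond.
    apply: ler_sum => x _; rewrite expn0 muln1; case: ifP => [/andP[-> hx1]|_].
      by rewrite (leq_trans hx1).
    by case: ifP => // _; exact: powR_ge0.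
  rewrite !expr0 !mulr1 /K ler_peMr // lerDl invr_ge0; lra.
have cover := @sum_seq_cover R T r (fun x => 1 <= h x <= 2 ^ J.+1)%N
  (fun x => 1 <= h x <= 2 ^ J)%N (fun x => 2 ^ J <= h x <= 2 * 2 ^ J)%N.
apply: le_trans (cover _ _ _) (le_trans (lerD IH (shell J)) _).
- by move=> x; exact: powR_ge0.
- by move=> x; rewrite expnS => /andP[-> h2] /=; case: (leqP (h x) (2 ^ J)) => //= /ltnW ->.
rewrite exprSr -[c * _]mulr1; apply: (@le_trans _ _ (q ^+ J * (K + c * q ^+ 0))).
  by rewrite expr0; lra.
by rewrite mulrA [K * _]mulrC -mulrA ler_wpM2l // exprn_ge0 // ltW // (lt_trans _ q1).
Qed.

(** The shells starting at m, 2m, 4m, ... form a geometric series of ratio q = 2^(-a) < 1, and K = c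
    / (1 - q) solves K = c + K * q. The induction peels off the innermost shell, so [m] doubles and
    has to stay general. It reaches the whole tail because [r] is finite. *)
Lemma dyadic_tail_sum (a : R) (m : nat) : 0 < a -> (0 < m)%N ->
  \sum_(x <- r | (m <= h x)%N) (h x)%:R `^ (- (D%:R + a))
    <= c * (1 - 2 `^ (- a))^-1 * m%:R `^ (- a).
Proof.
move=> a0 m0; set q := 2 `^ (- a); have q1 : q < 1 by apply: powR2_lt1; lra.
set K := c * _; have qK : c + K * q = K by rewrite /K; field; lra.
have K0 : 0 <= K by apply: mulr_ge0 => //; rewrite invr_ge0; lra.
have p0 : 0 <= D%:R + a by rewrite addr_ge0 // ltW.
have bounded_tail J : forall m, (0 < m)%N ->
    \sum_(x <- r | (m <= h x < 2 ^ J * m)%N) (h x)%:R `^ (- (D%:R + a))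
    <= K * m%:R `^ (- a).
  elim: J => [|J IH] {m0}m m0.
    rewrite big_pred0 => [|x]; first by rewrite mulr_ge0 // powR_ge0.
    rewrite mul1n; lia.
  have cover := @sum_seq_cover R T r (fun x => m <= h x < 2 ^ J.+1 * m)%N
    (fun x => m <= h x <= 2 * m)%N (fun x => 2 * m <= h x < 2 ^ J * (2 * m))%N.
  have mm0 : (0 < 2 * m)%N by rewrite muln_gt0.
  apply: le_trans (cover _ _ _) (le_trans (lerD (shell_sum m0 p0) (IH _ mm0)) _).
  - by move=> x; exact: powR_ge0.
  - move=> x /andP[-> h2]; move: h2; rewrite expnSr -mulnA /= => ->.
    by case: (leqP (h x) (2 * m)) => //= /ltnW ->.
  rewrite natrM powRM // -/q opprD addNKr -[X in _ <= X * _]qK; lra.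
pose M := \max_(x <- r) h x; apply: le_trans (bounded_tail M.+1 m m0).
rewrite le_eqVlt; apply/orP; left; apply/eqP.
rewrite big_seq_cond [RHS]big_seq_cond; apply: eq_bigl => x.
case xr: (x \in r) => //=; case: (m <= h x)%N => //=; apply/esym.
have hx : (h x <= M)%N by exact: leq_bigmax_seq.
apply: (@leq_trans (2 ^ M.+1)); last by rewrite leq_pmulr.
by apply: leq_ltn_trans hx (ltnW _); exact: ltn_expl.
Qed.
End DyadicSums.

(** * Real-valued probabilities *)

Section Prob.
Variables (R : realType) (disp : measure_display) (T : measurableType disp)
  (P : probability T R).

Definition Pr (A : set T) : R := fine (P A).

Lemma PrE (A : set T) : measurable A -> P A = (Pr A)%:E.
Proof. by move=> mA; rewrite /Pr fineK // fin_num_measure. Qed.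

Lemma Pr_ge0 (A : set T) : 0 <= Pr A.
Proof. by rewrite /Pr fine_ge0. Qed.

Lemma le_Pr (A B : set T) : measurable A -> measurable B -> A `<=` B -> Pr A <= Pr B.
Proof. by move=> mA mB AB; rewrite -lee_fin -!PrE // le_measure ?inE. Qed.

Lemma Pr_setT : Pr setT = 1.
Proof. by rewrite /Pr probability_setT. Qed.

Lemma Pr_set0 : Pr set0 = 0.
Proof. by rewrite /Pr measure0. Qed.

Lemma Pr_le1 (A : set T) : measurable A -> Pr A <= 1.
Proof. by move=> mA; rewrite -Pr_setT le_Pr. Qed.

Lemma Pr_setID (A B : set T) : measurable A -> measurable B ->
  Pr A = Pr (A `&` B) + Pr (A `\` B).
Proof.
move=> mA mB.
have mI : measurable (A `&` B) by exact: measurableI.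
have mD : measurable (A `\` B) by exact: measurableD.
have [mI' mD'] := (mI, mD).
apply: EFin_inj; rewrite EFinD -!PrE // -measureU //.
  by rewrite setUIDK.
by rewrite setDE setIACA setICr setI0.
Qed.

Lemma Pr_setU_le (A B : set T) : measurable A -> measurable B ->
  Pr (A `|` B) <= Pr A + Pr B.
Proof.
move=> mA mB; rewrite -lee_fin EFinD -!PrE //; last exact: measurableU.
exact: measureU2.
Qed.

Lemma Pr_bigcup_le (I : eqType) (r : seq I) (A : set T) (B : I -> set T) :
  measurable A -> (forall i, measurable (B i)) ->
  (forall t, A t -> exists2 i, i \in r & B i t) -> Pr A <= \sum_(i <- r) Pr (B i).
Proof.
move=> + mB; elim: r A => [|i r IH] A mA AB.
  rewrite big_nil (_ : A = set0) ?Pr_set0 //.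
  by apply/seteqP; split => // t /AB[].
rewrite big_cons.
have mD : measurable (A `\` B i) by exact: measurableD.
apply: (@le_trans _ _ (Pr (B i) + Pr (A `\` B i))).
  apply: le_trans (Pr_setU_le (mB i) mD); apply: le_Pr => //; first exact: measurableU.
  by move=> t At; case: (pselect (B i t)); [left|right].
rewrite lerD2l; apply: IH => // t [/AB[j]].
by rewrite inE => /predU1P[->//|jr Bj _]; exists j.
Qed.

Lemma Pr_sum_le (I : eqType) (r : seq I) (B : I -> set T) :
  uniq r -> (forall i, measurable (B i)) ->
  (forall i j t, B i t -> B j t -> i = j) ->
  forall A, measurable A -> (forall i, i \in r -> B i `<=` A) ->
  \sum_(i <- r) Pr (B i) <= Pr A.
Proof.
move=> + mB dB; elim: r => [|i r IH] /=; first by move=> _ A mA _; rewrite big_nil Pr_ge0.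
move=> /andP[ir ur] A mA BA; rewrite big_cons (Pr_setID mA (mB i)).
apply: lerD.
  apply: le_Pr => //; first exact: measurableI.
  by move=> t Bt; split => //; apply: BA Bt; rewrite inE eqxx.
apply: IH => //; first exact: measurableD.
move=> j jr t Bj; split; first by apply: BA Bj; rewrite inE jr orbT.
by move=> Bi; move: ir; rewrite (dB _ _ _ Bi Bj) jr.
Qed.

End Prob.

(** * Events that depend on finitely many independent coordinates *)

Definition supported (I : eqType) (l : seq I) (F : set (I -> bool)) : Prop :=
  forall v v' : I -> bool, {in l, v =1 v'} -> F v -> F v'.

(** Conditioning on coordinate [i]: where it equals [b], [force F i b] agrees with [F], and it no
    longer depends on [i]. *)
Definition force (I : eqType) (F : set (I -> bool)) (i : I) (b : bool) :
  set (I -> bool) := [set v | F (fun j => if j == i then b else v j)].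

Lemma supported_force (I : eqType) (i : I) (l : seq I) (F : set (I -> bool)) b :
  supported (i :: l) F -> supported l (force F i b).
Proof.
move=> sF v v' vv'; apply: sF => j; rewrite inE.
by case: eqP => //= _; exact: vv'.
Qed.

Lemma supportedI (I : eqType) (l1 l2 : seq I) (F G : set (I -> bool)) :
  supported l1 F -> supported l2 G -> supported (undup (l1 ++ l2)) (F `&` G).
Proof.
move=> s1 s2 v v' vv' [Fv Gv]; split.
  by apply: s1 Fv => i il; apply: vv'; rewrite mem_undup mem_cat il.
by apply: s2 Gv => i il; apply: vv'; rewrite mem_undup mem_cat il orbT.
Qed.

(* The probability of an event supported by [l]: a polynomial in the [p i], hence
   continuous in [beta], and the same for all independent families with marginals [p]. *)
Fixpoint bernoulli_poly (R : realType) (I : eqType) (p : I -> R) (l : seq I)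
    (F : set (I -> bool)) : R :=
  if l is i :: l' then
    p i * bernoulli_poly p l' (force F i true) +
    (1 - p i) * bernoulli_poly p l' (force F i false)
  else (`[< F (fun=> false) >])%:R.

Section Independent.
Variables (R : realType) (disp : measure_display) (T : measurableType disp)
  (P : probability T R) (I : choiceType) (X : I -> set T) (p : I -> R).
Hypothesis mX : forall i, measurable (X i).
Hypothesis XE : forall i, P (X i) = (p i)%:E.
Hypothesis indepX : independent_events P X.

Definition outcome (t : T) : I -> bool := fun i => `[< X i t >].

Let event (F : set (I -> bool)) : set T := [set t | F (outcome t)].

Let force_event i b F t : outcome t i = b -> force F i b (outcome t) = F (outcome t).
Proof.
move=> tb; rewrite /force /=; congr F; apply/funext => j.
by case: eqP => [->|].
Qed.

Let eventIX i F : event F `&` X i = event (force F i true) `&` X i.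
Proof.
apply/seteqP; split => t [Ft Xt]; split => //; move: Ft;
  by rewrite /event /= force_event //; apply/asboolP.
Qed.

Let eventDX i F : event F `\` X i = event (force F i false) `\` X i.
Proof.
apply/seteqP; split => t [Ft Xt]; split => //; move: Ft;
  by rewrite /event /= force_event //; apply/asboolP.
Qed.

Lemma measurable_supported l F : supported l F -> measurable (event F).
Proof.
elim: l F => [|i l IH] F sF.
  case: (pselect (F (fun=> false))) => F0.
    rewrite (_ : event F = setT) //; apply/seteqP; split => // t _.
    exact: sF F0.
  rewrite (_ : event F = set0) //; apply/seteqP; split => // t Ft.
  by apply: F0; apply: sF Ft.
rewrite -(setUIDK (event F) (X i)) eventIX eventDX.
by apply: measurableU; [apply: measurableI | apply: measurableD] => //;
  apply: IH; exact: supported_force.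
Qed.

Let bigX (A : {fset I}) : set T := \bigcap_(i in [set` A]) X i.

Let measurable_bigX A : measurable (bigX A).
Proof. by rewrite /bigX bigcap_fset; apply: bigsetI_measurable => i _. Qed.

Let Pr_bigX A : Pr P (bigX A) = \prod_(i <- A) p i.
Proof.
by rewrite /Pr (indepX A) (eq_bigr _ (fun i _ => XE i)) prodEFin.
Qed.

(** Splitting along [X i] replaces [F] by an event supported on the shorter list. The extra event
    [Q] carries the induction: its intersection with [X i] and its difference with [X i] both
    inherit the product rule for the remaining coordinates. *)
Lemma Pr_supportedI l F Q : uniq l -> supported l F -> measurable Q ->
  (forall A : {fset I}, {subset A <= l} ->
     Pr P (bigX A `&` Q) = (\prod_(i <- A) p i) * Pr P Q) ->
  Pr P (event F `&` Q) = bernoulli_poly p l F * Pr P Q.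
Proof.
elim: l F Q => [|i l IH] F Q /=.
  move=> _ sF mQ _; case: asboolP => F0.
    rewrite mul1r (_ : event F = setT) ?setTI //; apply/seteqP; split => // t _.
    exact: sF F0.
  rewrite mul0r (_ : event F = set0) ?set0I ?Pr_set0 //; apply/seteqP; split => // t Ft.
  by apply: F0; apply: sF Ft.
move=> /andP[il ul] sF mQ indepQ.
have mF : measurable (event F) by exact: measurable_supported sF.
have bigXU A : bigX A `&` (Q `&` X i) = bigX (i |` A)%fset `&` Q.
  by rewrite /bigX bigcap_fsetU1 setIA setIC setIA.
have QX : Pr P (Q `&` X i) = p i * Pr P Q.
  have := bigXU fset0; rewrite /bigX set_fset0 bigcap_set0 setTI => ->.
  rewrite indepQ ?fsetU0 ?big_seq_fset1 // => j.
  by rewrite !inE => ->.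
have QDX : Pr P (Q `\` X i) = (1 - p i) * Pr P Q.
  by have := Pr_setID P mQ (mX i); rewrite QX; lra.
have indepQX (A : {fset I}) : {subset A <= l} ->
    Pr P (bigX A `&` (Q `&` X i)) = (\prod_(i <- A) p i) * Pr P (Q `&` X i).
  move=> Al; rewrite bigXU indepQ; last first.
    by move=> j; rewrite !inE => /predU1P[->|/Al ->]; rewrite ?eqxx ?orbT.
  rewrite big_fsetU1 /= ?QX; first by ring.
  by apply/negP => /Al; exact/negP.
rewrite (@Pr_setID _ _ _ P _ (X i)) //; last exact: measurableI.
rewrite setIAC eventIX -setIA [X i `&` Q]setIC -[_ `\` X i]setIDA -setIDAC eventDX setIDAC.
rewrite !IH //.
- by rewrite QX QDX; ring.
- exact: supported_force.
- exact: measurableD.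
- move=> A Al.
  have mAQ : measurable (bigX A `&` Q) by exact: measurableI.
  have := Pr_setID P mAQ (mX i).
  rewrite indepQ; last by move=> j /Al jl; rewrite inE jl orbT.
  rewrite -setIA indepQX // -setIDA QX QDX; lra.
- exact: supported_force.
- exact: measurableI.
Qed.

Lemma Pr_supported l F : uniq l -> supported l F ->
  Pr P (event F) = bernoulli_poly p l F.
Proof.
move=> ul sF; rewrite -[event F]setIT (Pr_supportedI ul sF) ?Pr_setT ?mulr1 //.
by move=> A _; rewrite setIT Pr_bigX mulr1.
Qed.

(** [Pr_supportedI] is applied twice: with the event of [G] as [Q], and, to verify the product rule
    that this requires, with [G] as the supported event and an intersection of sets [X i] over [A]
    as [Q]. There disjointness of the lists makes the product over the union of [A] and [B]
    split. *)
Lemma Pr_independent l1 l2 F G : uniq l1 -> uniq l2 ->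
  (forall i, i \in l1 -> i \in l2 -> False) -> supported l1 F -> supported l2 G ->
  Pr P (event F `&` event G) = Pr P (event F) * Pr P (event G).
Proof.
move=> u1 u2 dis s1 s2; rewrite (Pr_supportedI u1 s1).
- by rewrite (Pr_supported u1 s1).
- exact: measurable_supported s2.
move=> A Al1; rewrite setIC (Pr_supportedI u2 s2) //.
  by rewrite (Pr_supported u2 s2) Pr_bigX mulrC.
move=> B Bl2; rewrite Pr_bigX -[bigX B `&` _](_ : bigX (B `|` A)%fset = _); last first.
  by rewrite /bigX set_fsetU bigcap_setU.
rewrite Pr_bigX (perm_big (enum_fset B ++ enum_fset A)) ?big_cat //.
apply: uniq_perm => [||i]; last by rewrite inE mem_cat.
  exact: fset_uniq.
rewrite cat_uniq !fset_uniq andbT /=; apply/hasPn => i iA; apply/negP => iB.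
exact: dis (Al1 _ iA) (Bl2 _ iB).
Qed.

End Independent.

Lemma continuous_bernoulli_poly (R : realType) (I : eqType) (p : R -> I -> R) (l : seq I)
    (F : set (I -> bool)) :
  (forall i, continuous (p^~ i)) -> continuous (fun b => bernoulli_poly (p b) l F).
Proof.
move=> cp; elim: l F => [|i l IH] F b; first exact: cvg_cst.
apply: cvgD; apply: cvgM; [exact: cp|exact: IH| |exact: IH].
by apply: cvgB; [exact: cvg_cst|exact: cp].
Qed.

(** * Open paths and clusters in finite sets, and the edges they depend on *)

Section Edges.
Variable d : nat.
Implicit Types (x y a b : site d) (e : edge d) (w : config d) (A S C : {fset site d})
  (D : rel (site d)) (L : seq (site d)).

Definition ends e : site d * site d :=
  (nth 0 (enum_fset (val e)) 0, nth 0 (enum_fset (val e)) 1).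

Lemma endsP e : (ends e).1 != (ends e).2 /\ val e = [fset (ends e).1; (ends e).2].
Proof.
case: e => e he; rewrite /ends [val _]/=.
have [ue memE] : uniq (enum_fset e) /\ forall z, (z \in e) = (z \in enum_fset e).
  by split; [exact: fset_uniq|].
have sz : size (enum_fset e) = 2 by exact/eqP.
case: (enum_fset e) sz ue memE => [|a [|b []]] //= _; rewrite inE andbT => ab memE.
by split => //; apply/fsetP => z; rewrite memE !inE.
Qed.

Lemma open_edge_val w e a b : val e = [fset a; b] -> open_edge w a b = w e.
Proof. by move=> eab; rewrite /open_edge -eab valK. Qed.

(** [D] has to hold for only one order of the two ends. A condition such as a in [C] and b in [S]
    thus selects the edges within the list that join a site of [C] to a site of [S], in either
    order. *)
Definition edges_of (D : rel (site d)) (L : seq (site d)) : seq (edge d) :=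
  undup (pmap (fun ab => insub [fset ab.1; ab.2])
    [seq ab <- [seq (a, b) | a <- L, b <- L] | D ab.1 ab.2]).

Lemma mem_edges_of D L e : reflect
  (exists a b, [/\ D a b, a \in L, b \in L & val e = [fset a; b]]) (e \in edges_of D L).
Proof.
rewrite mem_undup mem_pmap; apply: (iffP mapP).
  case=> -[a b]; rewrite mem_filter => /andP[/= Dab /allpairsP[[a' b'] /= [a'L b'L ab]]] eab.
  case: ab a'L b'L => <- <- aL bL {a' b'}.
  exists a, b; split => //.
  by move: eab; case: insubP => // e' _ <- [->].
case=> a [b [Dab aL bL eab]]; exists (a, b); last by rewrite -eab valK.
by rewrite mem_filter Dab; apply/allpairsP; exists (a, b).
Qed.

Lemma uniq_edges_of D L : uniq (edges_of D L).
Proof. exact: undup_uniq. Qed.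

Lemma open_edge_agree D L (w w' : edge d -> bool) a b :
  {in edges_of D L, w =1 w'} -> D a b -> a \in L -> b \in L ->
  open_edge w a b = open_edge w' a b.
Proof.
move=> ww' Dab aL bL; rewrite /open_edge; case: insubP => //= e _ eab.
by apply: ww'; apply/mem_edges_of; exists a, b.
Qed.

Definition inside A : rel (site d) := fun a b => (a \in A) && (b \in A).

(** The empty path is allowed everywhere, so from a site outside [A] exactly that site itself is
    reached. *)
Definition conn A (w : edge d -> bool) x y : Prop :=
  exists p, path (fun a b => inside A a b && open_edge w a b) x p /\ last x p = y.

Lemma supported_conn A x y :
  supported (edges_of (inside A) A) [set w | conn A w x y].
Proof.
move=> w w' ww' [p [pp py]]; exists p; split => //.
apply: sub_path pp => a b /andP[ab]; rewrite ab.
have [aA bA] := andP ab.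
by rewrite (open_edge_agree ww').
Qed.

Lemma supported_open_edge a b :
  supported (edges_of (fun y z => (y == a) && (z == b)) [:: a; b]) [set w | open_edge w a b].
Proof.
by move=> w w' ww' /=; rewrite (open_edge_agree ww') ?inE ?eqxx ?orbT.
Qed.

Lemma conn_refl A w x : conn A w x x.
Proof. by exists [::]. Qed.

Lemma conn_step A w x y z : conn A w x y -> y \in A -> z \in A -> open_edge w y z ->
  conn A w x z.
Proof.
move=> [p [pp py]] yA zA yz; exists (rcons p z); rewrite last_rcons; split => //.
by rewrite rcons_path pp py /inside yA zA yz.
Qed.

Lemma conn_mem A w x y : x \in A -> conn A w x y -> y \in A.
Proof.
move=> xA [p [+ <-]]; elim: p x xA => //= z p IH x xA /andP[/andP[/andP[_ zA] _]].
exact: IH.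
Qed.

Lemma sub_conn A B w x y : {subset A <= B} -> conn A w x y -> conn B w x y.
Proof.
move=> AB [p [pp py]]; exists p; split => //.
by apply: sub_path pp => a b /andP[/andP[/AB ? /AB ?] ?]; apply/andP; split => //; apply/andP.
Qed.

Lemma conn_connected_in A (w : config d) x y : conn A w x y -> connected_in w x y.
Proof. by move=> [p [pp py]]; exists p; split => //; apply: sub_path pp => a b /andP[]. Qed.

Lemma connected_in_conn (w : config d) x y : connected_in w x y ->
  exists L : {fset site d}, forall A, {subset L <= A} -> conn A w x y.
Proof.
move=> [p [pp py]]; exists [fset z in x :: p]%fset => A LA; exists p; split => //.
have : all (fun z => z \in A) (x :: p) by apply/allP => z zp; apply: LA; rewrite in_fset.
elim: p x {py LA} pp => //= z p IH x /andP[xz zp] /and3P[xA zA pA].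
by rewrite /inside xA zA xz; apply: IH => //=; rewrite zA.
Qed.

Definition cluster_event S x C : set (edge d -> bool) :=
  [set w | forall u, u \in C <-> conn S w x u].

(* Exploring a cluster inside [S] reveals only the edges that meet it. *)
Lemma supported_cluster_event S x C : x \in S -> {subset C <= S} ->
  supported (edges_of (fun a b => (a \in C) && (b \in S)) S) (cluster_event S x C).
Proof.
move=> xS CS w w' ww' Cw.
have agree a b : a \in C -> b \in S -> open_edge w a b = open_edge w' a b.
  by move=> aC bS; apply: (open_edge_agree ww') => //; [rewrite aC bS|exact: CS].
have xC : x \in C by apply/Cw; exact: conn_refl.
move=> u; split.
  move=> /Cw[p [pp pu]]; exists p; split => //.
  elim: p (x) xC pp {pu} => [//|z p IH] y yC /= /andP[/andP[/andP[yS zS] yz] pp].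
  have zC : z \in C by apply/Cw; apply: conn_step yz => //; exact/Cw.
  by rewrite /inside yS zS -agree // yz; exact: IH.
move=> [p [pp <-]].
elim: p (x) xC pp => [//|z p IH] y yC /= /andP[/andP[/andP[yS zS] yz] pp].
apply: IH pp; apply/Cw; apply: (@conn_step _ _ _ y) => //; first exact/Cw.
by rewrite agree.
Qed.

End Edges.

(** * Translations *)

Section Shift.
Variable d : nat.
Implicit Types (x y : site d) (e : edge d).

Definition translate x (A : {fset site d}) : {fset site d} := [fset (a + x)%R | a in A]%fset.

Lemma mem_translate x A a : (a + x \in translate x A) = (a \in A).
Proof. exact: (mem_imfset _ _ (@addIr _ x)). Qed.

Lemma translateP x A b : (b \in translate x A) = (b - x \in A).
Proof. by rewrite -{1}[b](subrK x) mem_translate. Qed.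

Fact shift_subproof x e : #|` translate x (val e)| == 2.
Proof. by rewrite card_imfset; [exact: (valP e)|exact: addIr]. Qed.

Definition shift x e : edge d := Sub (translate x (val e)) (shift_subproof x e).

Lemma val_shift x e a b : val e = [fset a; b]%fset ->
  val (shift x e) = [fset (a + x)%R; (b + x)%R]%fset.
Proof. by move=> eab; rewrite /shift SubK eab /translate imfset_fset2. Qed.

Lemma shift_inj x : injective (shift x).
Proof.
move=> e e' /(congr1 val); rewrite !SubK => ee'; apply/val_inj/fsetP => a.
by rewrite -(mem_translate x) ee' mem_translate.
Qed.

Lemma open_edge_shift x (w : edge d -> bool) a b :
  open_edge (fun e => w (shift x e)) a b = open_edge w (a + x) (b + x).
Proof.
rewrite /open_edge; case: insubP => [e _ eab|] /=.
  by rewrite -(val_shift x eab) valK.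
rewrite cardfs2 eqSS eqb1 negbK => /eqP ->.
by rewrite insubN // cardfs2 eqxx.
Qed.

Lemma conn_shift x A (w : edge d -> bool) a b :
  conn A (fun e => w (shift x e)) a b <-> conn (translate x A) w (a + x) (b + x).
Proof.
split=> [[p [pp <-]]|[p [pp pb]]].
  exists [seq y + x | y <- p]; rewrite (last_map (fun y => y + x)); split => //.
  rewrite (@path_map _ _ (fun y => y + x)); apply: sub_path pp => y z /=.
  by rewrite /inside !mem_translate open_edge_shift.
exists [seq y - x | y <- p]; rewrite -[a](addrK x); split.
  rewrite (@path_map _ _ (fun y => y - x)); apply: sub_path pp => y z /=.
  by rewrite /inside !translateP open_edge_shift !subrK.
by rewrite (last_map (fun y => y - x)) pb addrK.
Qed.

End Shift.

(** * Finite-volume events under the percolation law *)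

Definition edge_prob (R : realType) (d : nat) (J : site d -> site d -> R) (beta : R)
  (e : edge d) : R := 1 - expR (- (beta * J (ends e).1 (ends e).2)).

Lemma continuous_edge_prob (R : realType) (d : nat) (J : site d -> site d -> R) e :
  continuous (fun beta => edge_prob J beta e).
Proof.
move=> b; apply: cvgB; first exact: cvg_cst.
apply: continuous_comp; last exact: continuous_expR.
by apply: cvgN; apply: cvgM; [exact: cvg_id|exact: cvg_cst].
Qed.

Section Law.
Variables (R : realType) (d : nat) (J : site d -> site d -> R) (beta : R)
  (P : probability (config d) R).
Hypotheses (hJ : percolation_kernel J) (beta0 : 0 <= beta)
  (hP : percolation_law J beta P).
Implicit Types (x y a b u v : site d) (A S C : {fset site d}).

Let X (e : edge d) : set (config d) := [set w | w e].

Lemma measurable_open (e : edge d) : measurable (X e).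
Proof. by apply: sub_sigma_algebra; exists e. Qed.

Lemma outcomeE (w : config d) : outcome X w = w.
Proof. by apply/funext => e; rewrite /outcome /X /=; exact: asboolb. Qed.

Lemma Pr_edge (e : edge d) a b : val e = [fset a; b]%fset -> a != b ->
  P (X e) = (1 - expR (- (beta * J a b)))%:E.
Proof.
move=> eab ab; rewrite -(law_marginal hP ab); congr (P _).
by apply/seteqP; split => w /=; rewrite (open_edge_val _ eab).
Qed.

Lemma PrX (e : edge d) : P (X e) = (edge_prob J beta e)%:E.
Proof. by have [ab eab] := endsP e; exact: Pr_edge. Qed.

Lemma measurable_event l (F : set (edge d -> bool)) : supported l F ->
  measurable (F : set (config d)).
Proof.
move=> /(measurable_supported measurable_open).
by rewrite (_ : [set t | _] = F) //; apply/seteqP; split => w /=; rewrite outcomeE.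
Qed.

Lemma Pr_event l (F : set (edge d -> bool)) : uniq l -> supported l F ->
  Pr P (F : set (config d)) = bernoulli_poly (edge_prob J beta) l F.
Proof.
move=> ul sF; rewrite -(Pr_supported measurable_open PrX (law_independent hP) ul sF).
by congr (Pr P _); apply/seteqP; split => w /=; rewrite outcomeE.
Qed.

Lemma Pr_event_independent l1 l2 (F G : set (edge d -> bool)) : uniq l1 -> uniq l2 ->
  (forall e, e \in l1 -> e \in l2 -> False) -> supported l1 F -> supported l2 G ->
  Pr P (F `&` G : set (config d)) = Pr P (F : set (config d)) * Pr P (G : set (config d)).
Proof.
move=> u1 u2 dis s1 s2.
have := Pr_independent measurable_open PrX (law_independent hP) u1 u2 dis s1 s2.
rewrite (_ : [set t | F _] = F); last by apply/seteqP; split => w /=; rewrite outcomeE.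
by rewrite (_ : [set t | G _] = G) //; apply/seteqP; split => w /=; rewrite outcomeE.
Qed.

Lemma Pr_open_le a b : a != b ->
  Pr P [set w : config d | open_edge w a b] <= beta * J a b.
Proof.
move=> ab; rewrite /Pr (law_marginal hP ab) /=.
by have := expR_ge1Dx (- (beta * J a b)); lra.
Qed.

(** The shifted edge variables [Y] are again independent, with the same marginals because [J] is
    translation invariant. Both probabilities are therefore the same [bernoulli_poly]. *)
Lemma Pr_event_shift x l (F : set (edge d -> bool)) : uniq l -> supported l F ->
  Pr P [set w : config d | F (fun e => w (shift x e))] =
  Pr P (F : set (config d)).
Proof.
move=> ul sF; rewrite (Pr_event ul sF).
pose Y (e : edge d) : set (config d) := [set w | w (shift x e)].
have mY e : measurable (Y e) by exact: measurable_open.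
have YE e : P (Y e) = (edge_prob J beta e)%:E.
  have [ab eab] := endsP e.
  rewrite (Pr_edge (val_shift x eab)); last by rewrite (inj_eq (addIr x)).
  rewrite /edge_prob [in RHS](kernel_translation hJ) [in LHS](kernel_translation hJ).
  by rewrite opprD addrACA subrr addr0.
have indepY : independent_events P Y.
  move=> A; have := law_independent hP (shift x @` A)%fset.
  rewrite big_imfset /=; last by move=> e e' _ _; exact: shift_inj.
  move=> <-; congr (P _); apply/seteqP; split => w Yw e eA.
    by have /imfsetP[e' /= e'A ->] := eA; exact: Yw.
  by apply: Yw => /=; exact: in_imfset.
rewrite -(Pr_supported mY YE indepY ul sF); congr (Pr P _).
apply/seteqP; split => w /=; rewrite (_ : outcome Y w = (fun e => w (shift x e))) //;
  by apply/funext => e; exact: asboolb.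
Qed.

Lemma Pr_conn_translate x A a b :
  Pr P [set w : config d | conn (translate x A) w (a + x) (b + x)] =
  Pr P [set w : config d | conn A w a b].
Proof.
rewrite -(Pr_event_shift x (uniq_edges_of _ _) (@supported_conn d A a b)).
congr (Pr P _); apply/seteqP; split => w; [exact: (conn_shift x A w a b).2|].
exact: (conn_shift x A w a b).1.
Qed.

Lemma measurable_conn A a b : measurable [set w : config d | conn A w a b].
Proof. exact: measurable_event (@supported_conn d A a b). Qed.

End Law.

(** * The Simon-Lieb inequality and the expected cluster size *)

(** The edge is the last one by which the path leaves [C]. The induction keeps the alternative that
    the path read so far from its end avoids [C] altogether; the first site of [C] met backwards
    then yields the exit. *)
Lemma conn_exit (d : nat) (C L : {fset site d}) (w : edge d -> bool) (x y : site d) :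
  x \in C -> y \notin C -> conn L w x y ->
  exists u v, [/\ u \in C, v \in (L `\` C)%fset, open_edge w u v & conn (L `\` C)%fset w v y].
Proof.
move=> xC yC [p [pp py]]; suff : x \notin C /\ conn (L `\` C)%fset w x y \/
    exists u v, [/\ u \in C, v \in (L `\` C)%fset, open_edge w u v & conn (L `\` C)%fset w v y].
  by case=> // -[]; rewrite xC.
elim: p x {xC} pp py => [|z p IH] x /=.
  by move=> _ ->; left; split => //; exact: conn_refl.
move=> /andP[/andP[/andP[xL zL] xz] pp] /(IH _ pp) [[zC zy]|]; last by right.
have [xC|xC] := boolP (x \in C).
  by right; exists x, z; split => //; rewrite in_fsetD zC.
left; split => //; case: zy => q [qq qy]; exists (z :: q); split => //=.
by rewrite /inside !in_fsetD xC zC xL zL xz.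
Qed.

Section Susceptibility.
Variables (R : realType) (d : nat) (J : site d -> site d -> R) (beta : R)
  (P : probability (config d) R).
Hypotheses (hJ : percolation_kernel J) (beta0 : 0 <= beta)
  (hP : percolation_law J beta P).
Implicit Types (x y a b u v : site d) (A S C L : {fset site d}).

Let pconn A x y : R := Pr P [set w : config d | conn A w x y].

Let mcluster S x C : x \in S -> (C `<=` S)%fset ->
  measurable (cluster_event S x C : set (config d)).
Proof.
by move=> xS /fsubsetP CS; apply: measurable_event; exact: supported_cluster_event.
Qed.

(** The cluster of [x] in [S] has one value, so the events are disjoint for different [C]; each with
    [u] in [C] forces the connection. *)
Lemma Pr_cluster_event_sum S x u : x \in S ->
  \sum_(C <- fpowerset S | u \in C) Pr P (cluster_event S x C : set (config d))
    <= pconn S x u.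
Proof.
move=> xS.
pose B C : set (config d) :=
  if (C `<=` S)%fset && (u \in C) then cluster_event S x C else set0.
have mB C : measurable (B C).
  by rewrite /B; case: ifP => [/andP[CS _]|_]; [exact: mcluster|exact: measurable0].
rewrite big_mkcond big_seq_cond (eq_bigr (fun C => Pr P (B C))); last first.
  move=> C; rewrite andbT fpowersetE /B => ->.
  by case: ifP => //= _; rewrite Pr_set0.
rewrite -big_seq_cond; apply: Pr_sum_le => //.
- by rewrite fset_uniq.
- move=> C C' w; rewrite /B; case: ifP => // _ CE; case: ifP => // _ CE'.
  apply/fsetP => v; apply/idP/idP; first by move/CE/CE'.
  by move/CE'/CE.
- exact: measurable_conn.
- by move=> C _ w; rewrite /B; case: ifP => // /andP[_ uC] /= /(_ u) h; exact/h.
Qed.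

(** The cluster event reads edges inside [S] that meet [C], the edge from [u] to [v] leaves [S], and
    the last connection reads edges that avoid [C], whereas [u] lies in [C]. *)
Lemma Pr_exit_le S L C x u v y : x \in S -> (C `<=` S)%fset -> u \in C -> v \notin S ->
  Pr P (cluster_event S x C `&` ([set w | open_edge w u v] `&`
    [set w | conn (L `\` C)%fset w v y]) : set (config d))
  <= Pr P (cluster_event S x C : set (config d)) * (beta * J u v * pconn L v y).
Proof.
move=> xS /fsubsetP CS uC vS.
have vC : v \notin C by apply: contra vS; exact: CS.
have sC := supported_cluster_event xS CS.
have sO := @supported_open_edge d u v.
have sL := @supported_conn d (L `\` C)%fset v y.
set l1 := edges_of _ _ in sC; set l2 := edges_of _ _ in sO; set l3 := edges_of _ _ in sL.
have e1 e : e \in l1 -> (exists2 a, a \in val e & a \in C) /\ {subset val e <= S}.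
  move=> /mem_edges_of[a [b [/andP[aC bS] aS _ ->]]]; split.
    by exists a; rewrite // !inE eqxx.
  by move=> z; rewrite !inE => /orP[/eqP ->|/eqP ->].
have e2 e : e \in l2 -> u \in val e /\ v \in val e.
  by move=> /mem_edges_of[a [b [/andP[/eqP -> /eqP ->] _ _ ->]]]; rewrite !inE !eqxx orbT.
have e3 e : e \in l3 -> forall z, z \in val e -> z \notin C.
  move=> /mem_edges_of[a [b [_ + + ->]]] z; rewrite !in_fsetD !inE.
  by move=> /andP[aC _] /andP[bC _] /orP[/eqP ->|/eqP ->].
rewrite (@Pr_event_independent R d J beta P hP l1 (undup (l2 ++ l3))) //.
- rewrite ler_wpM2l ?Pr_ge0 //.
  rewrite (@Pr_event_independent R d J beta P hP l2 l3) //.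
  + apply: ler_pM; rewrite ?Pr_ge0 //.
      apply: Pr_open_le => //; by apply: contraNneq vC => <-.
    apply: le_Pr; [exact: measurable_conn|exact: measurable_conn|].
    by move=> w; apply: sub_conn => z; rewrite in_fsetD => /andP[].
  + exact: uniq_edges_of.
  + exact: uniq_edges_of.
  + by move=> e /e2[ue _] /e3 /(_ u ue); rewrite uC.
- exact: uniq_edges_of.
- exact: undup_uniq.
- move=> e /e1[[a ae aC] eS]; rewrite mem_undup mem_cat => /orP[/e2[_ /eS]|/e3 /(_ a ae)].
    by rewrite (negbTE vS).
  by rewrite aC.
- exact: supportedI.
Qed.

(* Condition on the cluster of [x] in [S] and look at the last exit from it: the three
   events involve disjoint sets of edges, so no BK inequality is needed. *)
Lemma simon_lieb S L x y : x \in S -> y \notin S ->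
  pconn L x y <= \sum_(u <- S) \sum_(v <- (L `\` S)%fset)
                   pconn S x u * (beta * J u v * pconn L v y).
Proof.
move=> xS yS.
pose B (t : {fset site d} * (site d * site d)) : set (config d) :=
  if [&& (t.1 `<=` S)%fset, t.2.1 \in t.1 & t.2.2 \notin S] then
    cluster_event S x t.1 `&` ([set w | open_edge w t.2.1 t.2.2] `&`
      [set w | conn (L `\` t.1)%fset w t.2.2 y]) else set0.
have mB t : measurable (B t).
  rewrite /B; case: ifP => [/and3P[CS _ _]|_]; last exact: measurable0.
  apply: measurableI; first exact: mcluster.
  apply: measurableI; last exact: measurable_conn.
  exact: measurable_event (@supported_open_edge d _ _).
pose r := [seq (C, uv) | C <- fpowerset S,
   uv <- [seq (u, v) | u <- S, v <- (L `\` S)%fset]].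
apply: (@le_trans _ _ (\sum_(t <- r) Pr P (B t))).
  apply: Pr_bigcup_le => //; first exact: measurable_conn.
  move=> w /= xy.
  pose C := [fset u in S | `[< conn S w x u >]]%fset.
  have CE u : (u \in C) = `[< conn S w x u >].
    rewrite !inE /=; case: asboolP => [xu|]; last by rewrite andbF.
    by rewrite andbT; exact: conn_mem xu.
  have CS : (C `<=` S)%fset by apply/fsubsetP => u; rewrite !inE => /andP[].
  have xC : x \in C by rewrite CE; apply/asboolP; exact: conn_refl.
  have yC : y \notin C by apply: contra yS; exact: (fsubsetP CS).
  have [u [v [uC + uv vy]]] := conn_exit xC yC xy.
  rewrite in_fsetD => /andP[vC vL].
  (* An open edge from [C] to a site of [S] would put that site in the cluster, so leaving [C] means
     leaving [S]. *)
  have vS : v \notin S.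
    apply: contra vC => vS; rewrite CE; apply/asboolP.
    move: (uC); rewrite CE => /asboolP xu; apply: conn_step uv => //.
    exact: (fsubsetP CS).
  exists (C, (u, v)).
    apply/allpairsP; exists (C, (u, v)); rewrite fpowersetE; split => //=.
    apply/allpairsP; exists (u, v); rewrite in_fsetD vS; split => //=.
    exact: (fsubsetP CS).
  rewrite /B /= CS uC vS; split => // z; rewrite CE; split; first by move/asboolP.
  by move=> ?; apply/asboolP.
(* For fixed [u] and [v] the sum over [C] is taken innermost, where it collapses to the probability
   that [x] is connected to [u] in [S]. *)
rewrite big_allpairs exchange_big big_allpairs_dep /=.
rewrite big_seq [leRHS]big_seq; apply: ler_sum => u uS.
rewrite big_seq [leRHS]big_seq; apply: ler_sum => v; rewrite in_fsetD => /andP[vS vL].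
have Jv0 : 0 <= beta * J u v * pconn L v y.
  by rewrite mulr_ge0 ?Pr_ge0 // mulr_ge0 // (kernel_ge0 hJ).
apply: le_trans (ler_wpM2r Jv0 (Pr_cluster_event_sum u xS)).
rewrite mulr_suml [leRHS]big_mkcond /= big_seq [leRHS]big_seq.
apply: ler_sum => C; rewrite fpowersetE => CS; rewrite /B /= CS vS andbT.
case: (boolP (u \in C)) => uC; last by rewrite Pr_set0.
exact: Pr_exit_le.
Qed.

Variables (S : {fset site d}) (out : site d -> R) (psi : R).
Hypotheses (S0 : 0 \in S)
  (outE : forall u (F : {fset site d}), u \in S -> {in F, forall v, v \notin S} ->
     \sum_(v <- F) J u v <= out u)
  (psiE : \sum_(u <- S) pconn S 0 u * (beta * out u) <= psi) (psi1 : psi < 1).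

(** At most |S| sites of [L] lie in the translate of [S] around the starting point; any other is
    reached through an exit from that translate, which costs [psi] in total and restarts the sum at
    the exit point. The hypothesis on [out] bounds the kernel leaving [S] through finite partial
    sums, which is all that a finite [L] calls for. *)
Lemma susceptibility_le L x :
  \sum_(y <- L) pconn L x y <= #|` S|%:R / (1 - psi).
Proof.
pose f z := \sum_(y <- L) pconn L z y.
have f_le z : f z <= #|` L|%:R.
  rewrite /f -[leRHS]mulr1n card_fset_sum1 natr_sum; apply: ler_sum => y _.
  by apply: Pr_le1; exact: measurable_conn.
have psi0 : 0 <= psi.
  apply: le_trans psiE; rewrite big_seq sumr_ge0 // => u uS.
  rewrite mulr_ge0 ?Pr_ge0 // mulr_ge0 //; apply: le_trans (outE (F := fset0) uS _) => //.
  by rewrite big_seq_fset0.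
(* [S] moves with [z] while [L] stays fixed, so a bound for all starting points at once is
   propagated. *)
have step M : (forall z, f z <= M) -> forall z, f z <= #|` S|%:R + psi * M.
  move=> fM z; pose Sz := translate z S.
  have zS : z \in Sz by rewrite translateP subrr.
  have M0 : 0 <= M by apply: le_trans (fM z); apply: sumr_ge0 => y _; exact: Pr_ge0.
  rewrite /f (bigID [in Sz]) /=; apply: lerD.
    apply: le_trans (sum_seq_le_count (c := 1) _ _) _.
      by move=> y _; apply: Pr_le1; exact: measurable_conn.
    rewrite mul1r ler_nat -size_filter.
    have -> : #|` S| = size (enum_fset Sz) by apply/esym; exact: (card_imfset _ _ (@addIr _ z)).
    apply: uniq_leq_size; first by rewrite filter_uniq // fset_uniq.
    by move=> y; rewrite mem_filter => /andP[].
  apply: (@le_trans _ _ (\sum_(u <- Sz) \sum_(v <- (L `\` Sz)%fset)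
      pconn Sz z u * (beta * J u v * M))).
    apply: le_trans (ler_sum _ (fun y yS => simon_lieb L zS yS)) _.
    rewrite exchange_big; apply: ler_sum => u _.
    rewrite exchange_big; apply: ler_sum => v _ /=.
    rewrite -mulr_sumr ler_wpM2l ?Pr_ge0 // -mulr_sumr ler_wpM2l //.
      by rewrite mulr_ge0 // (kernel_ge0 hJ).
    apply: le_trans (fM v); rewrite /f [leRHS](bigID [in Sz]) /= lerDr.
    by apply: sumr_ge0 => y _; exact: Pr_ge0.
  rewrite big_imfset /=; last by move=> ? ? _ _; exact: addIr.
  apply: le_trans (ler_wpM2r M0 psiE); rewrite mulr_suml big_seq [leRHS]big_seq.
  apply: ler_sum => a aS; rewrite -{1}[z]add0r /pconn (Pr_conn_translate hJ hP).
  rewrite -mulr_sumr -mulrA ler_wpM2l ?Pr_ge0 // -mulr_suml -mulr_sumr.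
  rewrite ler_wpM2r // ler_wpM2l //.
  apply: le_trans (outE (F := translate (- z) (L `\` Sz)%fset) aS _); last first.
    by move=> v; rewrite translateP opprK in_fsetD => /andP[]; rewrite mem_translate.
  rewrite [leRHS]big_imfset /=; last by move=> ? ? _ _; exact: (@addIr _ (- z)).
  apply: ler_sum => v _; rewrite (kernel_translation hJ) [leRHS](kernel_translation hJ).
  by rewrite addrAC opprD addrA.
have supP : has_sup (range f).
  by split; [exists (f 0); exists 0|exists #|` L|%:R => _ [z _ <-]].
have fsup z : f z <= sup (range f) by apply: sup_upper_bound => //; exists z.
apply: le_trans (fsup x) _; rewrite ler_pdivlMr ?subr_gt0 //.
rewrite mulrBr mulr1 lerBlDr [_ * psi]mulrC.
by apply: ge_sup => [|_ [z _ <-]]; [exists (f 0); exists 0|exact: step].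
Qed.

End Susceptibility.

(** * Exhaustion by finite windows and absence of an infinite cluster *)

Lemma ler_sum_fset (R : realDomainType) (T : choiceType) (A B : {fset T}) (F : T -> R) :
  (A `<=` B)%fset -> {in B, forall y, 0 <= F y} -> \sum_(y <- A) F y <= \sum_(y <- B) F y.
Proof.
move=> AB F0; rewrite (_ : \sum_(y <- A) F y = \sum_(y <- B) if y \in A then F y else 0).
  rewrite big_seq [leRHS]big_seq; apply: ler_sum => y yB.
  by case: ifP => // _; exact: F0.
rewrite -(big_fset_incl _ AB) => [|y _ /negbTE -> //].
by rewrite big_seq [RHS]big_seq; apply: eq_bigr => y ->.
Qed.

Section Exhaustion.
Variable d : nat.
Implicit Types (x y : site d) (L : {fset site d}).

(** The sites with code below [n] in a fixed enumeration. They increase to the whole lattice, and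
    the same codes index the events in the Borel-Cantelli argument. *)
Definition window (n : nat) : {fset site d} :=
  [fset y in pmap (@pickle_inv (site d)) (iota 0 n)]%fset.

Lemma mem_window n y : (y \in window n) = (choice.pickle y < n)%N.
Proof.
rewrite in_fset mem_pmap; apply/mapP/idP => [[k]|yn].
  rewrite mem_iota add0n => /= kn /esym yk.
  by have := @pickle_invK (site d : countType) k; rewrite yk /= => ->.
by exists (choice.pickle y); rewrite ?mem_iota ?add0n // pickleK_inv.
Qed.

Lemma sub_window L : exists n, {subset L <= window n}.
Proof.
exists (\max_(y <- L) choice.pickle y).+1 => y yL; rewrite mem_window ltnS.
exact: leq_bigmax_seq.
Qed.

Lemma le_window m n : (m <= n)%N -> {subset window m <= window n}.
Proof. by move=> mn y; rewrite !mem_window => /leq_trans; apply. Qed.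

(** Only finitely many sites have a code below a given [n]. In this form an infinite cluster is a
    limsup event. *)
Lemma infinite_setP_pickle (A : set (site d)) :
  infinite_set A <-> forall n, exists2 y, A y & (n <= choice.pickle y)%N.
Proof.
split=> [Ainf n|Apickle /finite_fsetP[L AL]].
  apply: contrapT => nA; apply: Ainf.
  apply: (@sub_finite_set _ _ [set` window n]); last exact: finite_fset.
  move=> y Ay /=; rewrite mem_window ltnNge; apply/negP => ny.
  by apply: nA; exists y.
have [n Ln] := sub_window L; have [y Ay] := Apickle n.
have yL : y \in L by move: Ay; rewrite AL.
by rewrite leqNgt -mem_window Ln.
Qed.

Lemma connected_in_window (w : config d) x y :
  connected_in w x y <-> exists n, conn (window n) w x y.
Proof.
split=> [/connected_in_conn[L Lw]|[n /conn_connected_in //]].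
by have [n Ln] := sub_window L; exists n; exact: Lw.
Qed.

Lemma bigcup_conn_window x y :
  \bigcup_n [set w : config d | conn (window n) w x y] = [set w | connected_in w x y].
Proof.
apply/seteqP; split => w /=; first by move=> [n _ ?]; apply/connected_in_window; exists n.
by move=> /connected_in_window[n ?]; exists n.
Qed.

End Exhaustion.

Section Window.
Variables (R : realType) (d : nat) (P : probability (config d) R).
Implicit Types x y : site d.

Lemma measurable_connected_in x y : measurable [set w : config d | connected_in w x y].
Proof.
by rewrite -bigcup_conn_window; apply: bigcup_measurable => n _; exact: measurable_conn.
Qed.

Lemma cvg_Pr_conn_window x y :
  Pr P [set w : config d | conn (window d n) w x y] @[n --> \oo]
    --> Pr P [set w : config d | connected_in w x y].
Proof.
apply: fine_cvg; rewrite -PrE; last exact: measurable_connected_in.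
rewrite -bigcup_conn_window; apply: nondecreasing_cvg_mu.
- by move=> n; exact: measurable_conn.
- by apply: bigcup_measurable => n _; exact: measurable_conn.
- move=> m n mn; apply/subsetPset => w /=; apply: sub_conn; exact: le_window.
Qed.

(* Borel--Cantelli applied to the events that [y] belongs to the cluster. *)
Lemma Pr_infinite_cluster0 (K : R) x :
  (forall L : {fset site d},
     \sum_(y <- L) Pr P [set w : config d | conn L w x y] <= K) ->
  P [set w : config d | infinite_set (Defs.cluster w x)] = 0%E.
Proof.
move=> sumK.
(* For m >= n the hypothesis on window [m] bounds the sum over window [n] of connections confined to
   window [m]; letting m grow removes the confinement. *)
have sumK' n : \sum_(y <- window d n) Pr P [set w : config d | connected_in w x y] <= K.
  have cvg_sum : \sum_(y <- window d n) Pr P [set w : config d | conn (window d m) w x y]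
      @[m --> \oo] --> \sum_(y <- window d n) Pr P [set w : config d | connected_in w x y].
    apply: cvg_big => //; first exact: add_continuous.
    by move=> y _; exact: cvg_Pr_conn_window.
  rewrite -(cvg_lim _ cvg_sum) //; apply: limr_le; first by apply: cvgP cvg_sum.
  exists n => // m /= nm; apply: le_trans (sumK (window d m)).
  apply: ler_sum_fset => [|y _]; last exact: Pr_ge0.
  by apply/fsubsetP; exact: le_window.
(* Integers that code no site get the empty event. *)
pose F n : set (config d) := if pickle_inv n is Some y then
  [set w : config d | connected_in w x (y : site d)] else set0.
have mF n : measurable (F n).
  by rewrite /F; case: pickle_inv => // y; exact: measurable_connected_in.
have -> : [set w : config d | infinite_set (Defs.cluster w x)] = lim_sup_set F.
  apply/seteqP; split => w /=.
    move=> /infinite_setP_pickle infw n _ /=; have [y xy ny] := infw n.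
    by exists (choice.pickle y) => //=; rewrite /F pickleK_inv.
  move=> Fw; apply/infinite_setP_pickle => n; have [k /= nk] := Fw n I.
  rewrite /F; have := @pickle_invK (site d : countType) k; case: pickle_inv => //= y yk xy.
  by exists y => //; rewrite yk.
apply: lim_sup_set_cvg0 => //.
apply: (@le_lt_trans _ _ K%:E); last exact: ltry.
apply: lime_le; first exact: is_cvg_nneseries.
apply: nearW => n; rewrite /index_iota subn0 (eq_bigr (fun i => oapp (fun y : site d =>
    (Pr P [set w : config d | connected_in w x y])%:E) 0%E (pickle_inv i))).
  rewrite -big_pmap; have := sumK' n; rewrite -lee_fin -sumEFin; congr (_ <= _)%E.
  apply/perm_big/uniq_perm; [exact: fset_uniq| |by move=> y; rewrite in_fset].
  by apply: pmap_uniq (iota_uniq 0 n); exact: pickle_invK.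
move=> i _; rewrite /F; case: pickle_inv => [y|] /=; last exact: measure0.
by rewrite PrE //; exact: measurable_connected_in.
Qed.

End Window.

(** * The lower bound at the critical parameter *)

Section Critical.
Variables (R : realType) (d : nat) (J : site d -> site d -> R)
  (P : R -> probability (config d) R).
Hypotheses (hJ : percolation_kernel J)
  (hP : forall beta : R, 0 <= beta -> percolation_law J beta (P beta))
  (beta_c_fin : (beta_c P < +oo)%E).

Lemma beta_c_ge0 : (0 <= beta_c P)%E.
Proof. by apply: le_ereal_inf_tmp => _ [b [b0 _] <-]; rewrite lee_fin. Qed.

Lemma fine_beta_c : (fine (beta_c P))%:E = beta_c P.
Proof. by rewrite fineK // ge0_fin_numE // beta_c_ge0. Qed.

Lemma fine_beta_c_ge0 : 0 <= fine (beta_c P).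
Proof. by rewrite fine_ge0 // beta_c_ge0. Qed.

Lemma critical_sum_ge1 (S : {fset site d}) (out : site d -> R) :
  0 \in S ->
  (forall u (F : {fset site d}), u \in S -> {in F, forall v, v \notin S} ->
     \sum_(v <- F) J u v <= out u) ->
  1 <= \sum_(u <- S) Pr (P (fine (beta_c P))) [set w : config d | conn S w 0 u] *
                     (fine (beta_c P) * out u).
Proof.
move=> S0 outE; set bc := fine (beta_c P); rewrite leNgt; apply/negP => lt1.
(* A single formula for all parameters b >= 0: this is the link between the measures at different
   [b]. *)
pose Phi b := \sum_(u <- S) bernoulli_poly (edge_prob J b)
  (edges_of (inside S) S) [set w | conn S w 0 u] * (b * out u).
have PhiE b : 0 <= b ->
    \sum_(u <- S) Pr (P b) [set w : config d | conn S w 0 u] * (b * out u) = Phi b.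
  move=> b0; apply: eq_bigr => u _; congr (_ * _).
  by apply: (Pr_event (hP b0)); [exact: uniq_edges_of|exact: supported_conn].
have cPhi : continuous Phi.
  apply: continuous_big => [|u _ b]; first exact: add_continuous.
  apply: cvgM; first by apply: continuous_bernoulli_poly => e; exact: continuous_edge_prob.
  by apply: cvgM; [exact: cvg_id|exact: cvg_cst].
rewrite PhiE ?fine_beta_c_ge0 // in lt1.
have : \forall b \near bc, Phi b < 1 by exact: (cvgr_lt _ (cPhi bc)).
move=> [e /= e0 Phi1].
(* The infimum supplies a parameter in [bc, bc + e) at which an infinite cluster has positive
   probability, and [Phi] is still below 1 there. *)
have : (beta_c P < (bc + e)%:E)%E.
  by rewrite -fine_beta_c lte_fin ltrDl.
move=> /ereal_inf_lt[_ [b [b0 binf] <-]]; rewrite lte_fin => be.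
have bcb : bc <= b.
  rewrite -lee_fin fine_beta_c; apply: ereal_inf_lbound; by exists b.
have Phib : Phi b < 1.
  by apply: Phi1 => /=; rewrite ler0_norm ?subr_le0 // opprB ltrBlDl.
move: binf; rewrite (_ : P b _ = 0%E) ?ltxx //.
apply: Pr_infinite_cluster0 => L.
by apply: (susceptibility_le hJ b0 (hP b0) S0 outE _ Phib); rewrite PhiE.
Qed.

End Critical.

(** * Comparison of the given norm with the sup norm *)

Section Norm.
Variables (R : realType) (d : nat) (nrm : 'rV[R]_d -> R).
Hypothesis hnrm : is_norm nrm.

Let nrmN u : nrm (- u) = nrm u.
Proof. by rewrite -scaleN1r (is_norm_scale hnrm) normrN normr1 mul1r. Qed.

Let nrm0 : nrm 0 = 0.
Proof. by rewrite -(scale0r 0) (is_norm_scale hnrm) normr0 mul0r. Qed.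

Lemma nrm_ge0 u : 0 <= nrm u.
Proof.
by have := is_norm_triangle hnrm u (- u); rewrite subrr nrm0 nrmN -mulr2n pmulrn_lge0.
Qed.

Lemma nrm_le_mx_norm : exists2 K : R, 0 <= K & forall u, nrm u <= K * `|u|.
Proof.
exists (\sum_(j < d) nrm (delta_mx 0 j)); first by apply: sumr_ge0 => j _; exact: nrm_ge0.
move=> u; rewrite {1}[u]row_sum_delta mulr_suml.
apply: (@le_trans _ _ (\sum_j nrm (u 0 j *: delta_mx 0 j))).
  elim/big_ind2: _ => [|x a y b xa yb|//]; first by rewrite nrm0.
  by apply: le_trans (is_norm_triangle hnrm _ _) _; exact: lerD.
apply: ler_sum => j _; rewrite (is_norm_scale hnrm) mulrC ler_wpM2l ?nrm_ge0 //.
by rewrite [leRHS]/Num.norm /= mx_normrE; apply/bigmax_geP; right => /=; exists (0, j).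
Qed.

Lemma continuous_nrm : continuous nrm.
Proof.
have [K K0 nrmK] := nrm_le_mx_norm => u.
have FF : Filter (nbhs u) by exact: nbhs_filter.
apply/(@cvgrPdist_le R _ _ (nbhs u) FF) => e e0.
have K1 : 0 < K + 1 by lra.
near=> v.
have uv : `|u - v| <= e / (K + 1).
  near: v; apply/nbhs_ballP; exists (e / (K + 1)); first exact: divr_gt0.
  by move=> v; rewrite -ball_normE => /ltW.
apply: (@le_trans _ _ (nrm (u - v))).
  have h1 := is_norm_triangle hnrm (u - v) v; rewrite subrK in h1.
  have h2 := is_norm_triangle hnrm (v - u) u; rewrite subrK -opprB nrmN in h2.
  by rewrite ler_norml; apply/andP; split; lra.
apply: le_trans (nrmK _) _; apply: (@le_trans _ _ ((K + 1) * `|u - v|)).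
  by rewrite ler_wpM2r //; lra.
by rewrite mulrC -ler_pdivlMr.
Unshelve. all: by end_near. Qed.

(** The constant is the minimum of [nrm] on the compact unit sphere of the sup norm, positive by
    definiteness; [0 < d] makes the sphere nonempty. *)
Lemma mx_norm_le_nrm : (0 < d)%N -> exists2 c : R, 0 < c & forall u, c * `|u| <= nrm u.
Proof.
move=> d0; pose sphere := [set u : 'rV[R]_d | `|u| = 1].
have cS : closed sphere.
  rewrite (_ : sphere = (@Num.norm R 'rV[R]_d) @^-1` [set 1]) //.
  apply: closed_comp => [u _|]; first exact: norm_continuous.
  exact: closed_eq.
have bS : bounded_set sphere.
  by exists 1; split => // M M1 u /= ->; exact: ltW.
have kS : compact sphere by exact: bounded_closed_compact.
have nz u : u != 0 -> sphere (`|u|^-1 *: u).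
  by move=> u0; rewrite /sphere /= normrZ normfV normr_id mulVf // normr_eq0.
have S0 : sphere !=set0.
  pose v : 'rV[R]_d := const_mx 1; exists (`|v|^-1 *: v); apply: nz.
  apply/eqP => /rowP /(_ (Ordinal d0)); rewrite !mxE => /eqP; exact/negP/oner_neq0.
have [u0 Su0 u0min] : exists2 u0, sphere u0 & forall u, sphere u -> nrm u0 <= nrm u.
  have [u0 Su0 u0min] := EVT_min_rV S0 kS (continuous_subspaceT continuous_nrm).
  by rewrite inE in Su0; exists u0 => // u Su; apply: u0min; rewrite inE.
exists (nrm u0).
  rewrite lt_neqAle nrm_ge0 andbT; apply/eqP => /esym /(is_norm_definite hnrm) u00.
  by move: Su0; rewrite u00 /sphere /= normr0 => /esym /eqP; exact/negP/oner_neq0.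
move=> u; have [->|un0] := eqVneq u 0; first by rewrite normr0 mulr0 nrm_ge0.
have := u0min _ (nz u un0); rewrite (is_norm_scale hnrm) normfV normr_id.
by rewrite mulrC ler_pdivlMr // normr_gt0.
Qed.

End Norm.

(** * Boxes of the lattice and their cardinality *)

Section SupNorm.
Variable d : nat.
Implicit Types (x y u v : site d) (n : nat).

Definition sup_norm x : nat := \max_(i < d) `|x ord0 i|%N.

Lemma sup_norm_leP x n : reflect (forall i, (`|x ord0 i| <= n)%N) (sup_norm x <= n)%N.
Proof. by apply: (iffP (bigmax_leqP _ _ _)) => h i; [exact: h|move=> _; exact: h]. Qed.

Lemma sup_norm0P x : (sup_norm x == 0)%N = (x == 0).
Proof.
rewrite -leqn0; apply/sup_norm_leP/eqP => [x0|-> i]; last by rewrite mxE.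
by apply/rowP => i; have := x0 i; rewrite mxE leqn0 absz_eq0 => /eqP.
Qed.

Lemma sup_norm_sub u v : (sup_norm v <= sup_norm u + sup_norm (u - v)%R)%N.
Proof.
apply/sup_norm_leP => i.
have ui : (`|u ord0 i| <= sup_norm u)%N by exact/sup_norm_leP.
have /sup_norm_leP/(_ i) := leqnn (sup_norm (u - v)%R); rewrite !mxE.
by move: (u ord0 i) (v ord0 i) ui => a b; lia.
Qed.

Definition box_site n (v : 'rV['I_(2 * n).+1]_d) : site d :=
  \row_(i < d) ((v ord0 i : nat)%:Z - n%:Z).

Definition box n : {fset site d} := [fset box_site v | v in {: 'rV['I_(2 * n).+1]_d}]%fset.

Lemma mem_box n x : (x \in box n) = (sup_norm x <= n)%N.
Proof.
apply/imfsetP/sup_norm_leP => [[v _ ->] i|xn].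
  rewrite mxE; have := ltn_ord (v ord0 i).
  by move: (v ord0 i : nat) => k; lia.
exists (\row_i inord `|(x ord0 i + n%:Z)%R|%N) => //.
apply/rowP => i; rewrite !mxE inordK; have := xn i; move: (x ord0 i) => a; lia.
Qed.

Lemma card_box n : (#|` box n| <= (2 * n).+1 ^ d)%N.
Proof.
apply: leq_trans (leq_imfset_card _ _ _) _.
by rewrite -cardE card_mx card_ord mul1n.
Qed.

Lemma count_sup_norm (f : site d -> site d) (F : {fset site d}) n : injective f ->
  (count (fun v => (sup_norm (f v) <= n)%N) F <= (2 * n).+1 ^ d)%N.
Proof.
move=> finj; apply: leq_trans (card_box n); rewrite -size_filter -(size_map f).
apply: uniq_leq_size; first by rewrite map_inj_uniq // filter_uniq // fset_uniq.
by move=> _ /mapP[v + ->]; rewrite mem_filter mem_box => /andP[].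
Qed.

(** The box of radius 2k has (4k + 1)^d <= (5k)^d sites. The injection [f] allows distances from any
    centre, as in v |-> u - v. *)
Lemma count_sup_norm_dyadic (R : realType) (f : site d -> site d) (F : {fset site d}) k :
  injective f -> (0 < k)%N ->
  (count (fun v => (sup_norm (f v) <= 2 * k)%N) F)%:R <= 5 ^+ d * k%:R ^+ d :> R.
Proof.
move=> finj k0; rewrite -exprMn -natrM -natrX ler_nat.
apply: leq_trans (count_sup_norm _ _ finj) _.
case: (posnP d) => [->|d0]; first by rewrite !expn0.
by rewrite leq_exp2r //; lia.
Qed.

Lemma sup_norm_le_site_norm (R : realType) (nrm : 'rV[R]_d -> R) :
  (0 < d)%N -> is_norm nrm ->
  exists2 c : R, 0 < c & forall x, c * (sup_norm x)%:R <= site_norm nrm x.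
Proof.
move=> d0 hnrm; have [c c0 hc] := mx_norm_le_nrm hnrm d0; exists c => // x.
apply: le_trans (hc _); apply: ler_wpM2l; first exact: ltW.
have [i ->] : exists i, sup_norm x = `|x ord0 i|%N.
  have [|i xi] := @bigop.eq_bigmax _ (fun i : 'I_d => `|x ord0 i|%N); first by rewrite card_ord.
  by exists i.
rewrite [leRHS]/Num.norm /= mx_normrE; apply/bigmax_geP; right; exists (0, i) => //=.
by rewrite mxE -intr_norm natr_absz.
Qed.

End SupNorm.

(** * Estimates for the kernel and the two-point function *)

Lemma powR_sup_norm_le (R : realType) (d : nat) (nrm : 'rV[R]_d -> R) (p : R) :
  (0 < d)%N -> is_norm nrm -> 0 <= p ->
  exists2 C : R, 0 <= C & forall x : site d, x != 0 ->
    site_norm nrm x `^ (- p) <= C * (sup_norm x)%:R `^ (- p).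
Proof.
move=> d0 hnrm p0; have [c c0 hc] := sup_norm_le_site_norm d0 hnrm.
exists (c `^ (- p)); first exact: powR_ge0.
move=> x x0; have n0 : 0 < (sup_norm x)%:R :> R by rewrite ltr0n lt0n sup_norm0P.
by rewrite -powRM ?ler0n ?(ltW c0) //; apply: powRN_le => //; exact: mulr_gt0.
Qed.

Lemma powR_natN_le (R : realType) (n : nat) (p q : R) : (0 < n)%N -> q <= p ->
  n%:R `^ (- p) <= n%:R `^ (- q) :> R.
Proof. by move=> n0 qp; apply: ler_powR; rewrite ?ler1n // lerN2. Qed.

(** A site outside the box has norm at least n + 1, so it is at distance at least n + 1 - |u| >= 1
    from [u], and the sum is a dyadic tail. Distances being at least 1, the exponent alpha may be
    lowered to [a]. *)
Lemma kernel_tail (R : realType) (d : nat) (nrm : 'rV[R]_d -> R) (J : site d -> site d -> R)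
    (C1 alpha a : R) :
  (0 < d)%N -> is_norm nrm -> 0 < a -> a <= alpha ->
  (forall x y : site d, x != y -> J x y <= C1 * site_norm nrm (x - y) `^ (- d%:R - alpha)) ->
  exists2 C : R, 0 <= C & forall n u (F : {fset site d}), u \in box d n ->
    {in F, forall v, v \notin box d n} ->
    \sum_(v <- F) J u v <= C * (n.+1 - sup_norm u)%:R `^ (- a).
Proof.
move=> d0 hnrm a0 aalpha Jdecay.
have p0 : 0 <= d%:R + alpha by rewrite addr_ge0 // (le_trans (ltW a0)).
have [c c0 hc] := powR_sup_norm_le d0 hnrm p0.
(* [C1] comes without a sign, hence the absolute value; [c] is the cost of changing norms and the
   rest is the constant of the dyadic tail. *)
exists (`|C1| * c * (5 ^+ d * (1 - 2 `^ (- a))^-1)).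
  rewrite !mulr_ge0 // ?exprn_ge0 // invr_ge0 subr_ge0 ltW //.
  by apply: powR2_lt1; rewrite oppr_lt0.
move=> n u F; rewrite mem_box => un Fn; set m := (n.+1 - sup_norm u)%N.
have m0 : (0 < m)%N by rewrite subn_gt0.
have far v : v \in F -> (m <= sup_norm (u - v)%R)%N.
  by move=> /Fn; rewrite mem_box -ltnNge => vn; have := sup_norm_sub u v; rewrite /m; lia.
have cnt k : (0 < k)%N ->
    (count (fun v => (sup_norm (u - v)%R <= 2 * k)%N) F)%:R <= 5 ^+ d * k%:R ^+ d :> R.
  apply: (@count_sup_norm_dyadic d R (fun v => u - v)) => v w /addrI; exact: oppr_inj.
have tail := dyadic_tail_sum cnt a0 m0.
have C0 := mulr_ge0 (normr_ge0 C1) c0.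
apply: le_trans (le_trans (ler_wpM2l C0 tail) _); last by rewrite !mulrA.
rewrite mulr_sumr big_seq [leRHS]big_seq_cond [leRHS]big_mkcond [leLHS]big_mkcond.
apply: ler_sum => v _; case vF: (v \in F) => //=; rewrite far //.
have uv : u - v != 0 by rewrite -sup_norm0P -lt0n (leq_trans m0) // far.
apply: le_trans (Jdecay _ _ _) _; first by rewrite -subr_eq0.
rewrite -opprD -mulrA; apply: (@le_trans _ _ (`|C1| * site_norm nrm (u - v) `^ (- (d%:R + alpha)))).
  by rewrite ler_wpM2r ?powR_ge0 // ler_norm.
rewrite ler_wpM2l //; apply: le_trans (hc _ uv) _; rewrite ler_wpM2l //.
by apply: powR_natN_le; rewrite ?lerD2l // (leq_trans m0) // far.
Qed.

(** The gap s - e absorbs the o(1) in the exponent far from the origin; on the remaining bounded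
    region [f] is at most 1 and the constant is enlarged. *)
Lemma two_point_le (R : realType) (d : nat) (nrm : 'rV[R]_d -> R)
    (f : site d -> \bar R) (e s : R) :
  (0 < d)%N -> is_norm nrm -> e < s -> s <= d%:R -> (forall x, fine (f x) <= 1) ->
  decays_with_exponent nrm f (- d%:R + e) ->
  exists2 C : R, 0 <= C & forall x, x != 0 ->
    fine (f x) <= C * (sup_norm x)%:R `^ (s - d%:R).
Proof.
move=> d0 hnrm es sd f1 [eps [eps0 feps]].
have p0 : 0 <= d%:R - s by rewrite subr_ge0.
have [c c0 hc] := powR_sup_norm_le d0 hnrm p0.
have [c' c'0 hc'] := sup_norm_le_site_norm d0 hnrm.
have : \forall x \near at_infinity nrm, fine (f x) <= site_norm nrm x `^ (- (d%:R - s)).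
  have near1 : \forall x \near at_infinity nrm, 1 <= site_norm nrm x.
    by exists 1 => // x /= /ltW.
  have near2 : \forall x \near at_infinity nrm, eps x < s - e.
    by apply: (cvgr_lt _ eps0); rewrite subr_gt0.
  near=> x; have -> : f x = (site_norm nrm x `^ (- d%:R + e + eps x))%:E by near: x.
  rewrite /=; apply: ler_powR; first by near: x.
  suff : eps x < s - e by lra.
  by near: x.
(* Every site of norm at most [M] has sup norm at most [K], so there K^(d-s) times the power of the
   sup norm is at least 1. *)
move=> [M _ hM]; pose K := Num.max 1 (M / c').
have K0 : 0 < K by rewrite lt_max ltr01.
exists (c + K `^ (d%:R - s)); first by rewrite addr_ge0 // powR_ge0.
move=> x x0; rewrite -[s - _]opprB mulrDl.
have [Mx|xM] := ltP M (site_norm nrm x).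
  apply: le_trans (hM _ Mx) _; apply: le_trans (hc _ x0) _.
  by rewrite lerDl mulr_ge0 ?powR_ge0.
apply: le_trans (f1 _) _.
apply: (@le_trans _ _ (K `^ (d%:R - s) * (sup_norm x)%:R `^ (- (d%:R - s)))).
  have n0 : 0 < (sup_norm x)%:R :> R by rewrite ltr0n lt0n sup_norm0P.
  rewrite powRN ler_pdivlMr ?powR_gt0 // mul1r.
  apply: ge0_ler_powR; rewrite ?nnegrE ?ler0n ?(ltW K0) //.
  rewrite le_max ler_pdivlMr // mulrC (le_trans (hc' x)) ?orbT //.
by rewrite lerDr mulr_ge0 ?powR_ge0.
Unshelve. all: by end_near. Qed.

(** For a site of norm [k], the quantity n + 1 - k takes each value 1, ..., N - k once as the radius
    [n] runs from [k] to N - 1. *)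
Lemma sum_powR_shift_le (R : realType) (a : R) (k N : nat) :
  \sum_(0 <= n < N | (k <= n)%N) (n.+1 - k)%:R `^ (- a) <=
  \sum_(0 <= j < N) j.+1%:R `^ (- a) :> R.
Proof.
have [kN|Nk] := leqP k N; last first.
  rewrite big_nat_cond big_pred0 => [|n]; last by lia.
  by apply: sumr_ge0 => j _; exact: powR_ge0.
rewrite (@big_cat_nat _ _ _ k) //= [X in X + _]big_nat_cond big_pred0 ?add0r => [|n]; last by lia.
rewrite -{1}[k]add0n big_addn [leRHS](@big_cat_nat _ _ _ (N - k)%N) ?leq_subr //=.
rewrite big_mkcond /= -[leLHS]addr0; apply: lerD.
  by apply: ler_sum => j _; rewrite leq_addl subSn ?leq_addl // addnK.
by apply: sumr_ge0 => j _; exact: powR_ge0.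
Qed.

Lemma exprn_unbounded (R : realType) (q K : R) : 1 < q -> exists n, K < q ^+ n.
Proof.
move=> q1; have bernoulli n : 1 + n%:R * (q - 1) <= q ^+ n.
  elim: n => [|n IH]; first by rewrite mul0r addr0.
  rewrite exprS; apply: le_trans (ler_wpM2l _ IH); last by lra.
  have : 0 <= n%:R * (q - 1) * (q - 1) by rewrite !mulr_ge0 ?subr_ge0 ?(ltW q1).
  by rewrite -natr1; lra.
exists (Num.bound `|K / (q - 1)|); apply: lt_le_trans (bernoulli _).
apply: (@lt_le_trans _ _ (`|K / (q - 1)| * (q - 1) + 1)).
  have := ler_norm (K / (q - 1)); rewrite ler_pdivrMr ?subr_gt0 //; lra.
rewrite addrC lerD2l ler_wpM2r ?subr_ge0 ?(ltW q1) //.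
by apply/ltW/archi_boundP.
Qed.

Lemma sum_two_point_le (R : realType) (d : nat) (tau : site d -> R) (C s : R) :
  (forall x, 0 <= tau x <= 1) -> 0 < s -> s <= d%:R -> 0 <= C ->
  (forall x, x != 0 -> tau x <= C * (sup_norm x)%:R `^ (s - d%:R)) ->
  exists2 K : R, 0 <= K & forall j, \sum_(u <- box d (2 ^ j)) tau u <= K * (2 `^ s) ^+ j.
Proof.
move=> tau01 s0 sd C0 tauC.
pose c : R := 5 ^+ d; have c0 : 0 <= c by rewrite exprn_ge0.
have q1 := powR2_gt1 s0.
have K0 : 0 <= c * (1 + (2 `^ s - 1)^-1).
  by rewrite mulr_ge0 // addr_ge0 // invr_ge0 subr_ge0 ltW.
exists (c + C * (c * (1 + (2 `^ s - 1)^-1))); first by rewrite addr_ge0 // mulr_ge0.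
move=> j; rewrite (bigID (fun u => sup_norm u == 0%N)) /= mulrDl; apply: lerD.
  apply: le_trans (sum_seq_le_count (c := 1) _ _) _.
    by move=> u _; have /andP[] := tau01 u.
  rewrite mul1r; apply: (@le_trans _ _ c).
    have := count_sup_norm_dyadic R (box d (2 ^ j)) (@inj_id (site d)) (isT : 0 < 1)%N.
    rewrite expr1n mulr1; apply: le_trans.
    by rewrite ler_nat; apply: sub_count => u /= /eqP ->.
  by rewrite ler_peMr // exprn_ege1 // ltW.
have cnt k : (0 < k)%N ->
    (count (fun u => (sup_norm u <= 2 * k)%N) (box d (2 ^ j)))%:R <= c * k%:R ^+ d.
  exact: (count_sup_norm_dyadic _ _ (@inj_id _)).
rewrite -mulrA; apply: le_trans (ler_wpM2l C0 (dyadic_sum cnt j s0 sd)).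
rewrite mulr_sumr big_seq_cond [leRHS]big_seq_cond [leRHS]big_mkcond [leLHS]big_mkcond.
apply: ler_sum => u _; rewrite mem_box lt0n.
case: (leqP (sup_norm u)) => //= _; rewrite andbT; case: (eqVneq (sup_norm u)) => //= u0.
by apply: tauC; rewrite -sup_norm0P.
Qed.

(** This is [dyadic_sum] in dimension 1 with h n = n + 1; the condition a < 1 makes the growth
    exponent 1 - a positive. *)
Lemma sum_powR_le (R : realType) (a : R) : 0 < a -> a < 1 ->
  exists2 K : R, 0 <= K &
    forall j, \sum_(0 <= k < 2 ^ j) k.+1%:R `^ (- a) <= K * (2 `^ (1 - a)) ^+ j.
Proof.
move=> a0 a1; have s0 : 0 < 1 - a by rewrite subr_gt0.
have s1 : 1 - a <= 1%N%:R by rewrite gerBl ltW.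
exists (2 * (1 + (2 `^ (1 - a) - 1)^-1)).
  by rewrite mulr_ge0 // addr_ge0 // invr_ge0 subr_ge0 ltW // powR2_gt1.
move=> j; have cnt k : (0 < k)%N ->
    (count (fun n => n.+1 <= 2 * k)%N (index_iota 0 (2 ^ j)))%:R <= 2 * k%:R ^+ 1 :> R.
  move=> _; rewrite expr1 -natrM ler_nat -size_filter -[leqRHS](size_iota 0).
  apply: uniq_leq_size; first by rewrite filter_uniq // iota_uniq.
  by move=> n; rewrite mem_filter mem_iota => /andP[].
apply: le_trans (dyadic_sum cnt j s0 s1).
rewrite [leLHS]big_nat [leRHS]big_mkcond [leLHS]big_mkcond /=; apply: ler_sum => n _.
case: ifP => // _; rewrite (_ : 1 - a - 1%N%:R = - a) //; lra.
Qed.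

Theorem theorem1p2 (R : realType) (d : nat) (hd : (1 <= d)%N)
  (nrm : 'rV[R]_d -> R) (hnrm : is_norm nrm)
  (alpha : R) (halpha0 : 0 < alpha) (halpha1 : d = 1%N -> alpha < 1)
  (J : site d -> site d -> R) (hJ : percolation_kernel J)
  (hJdecay : exists C1 : R, forall x y : site d, x != y ->
     J x y <= C1 * site_norm nrm (x - y) `^ (- d%:R - alpha))
  (P : R -> probability (config d) R)
  (hP : forall beta : R, 0 <= beta -> percolation_law J beta (P beta))
  (hbeta_c : (beta_c P < +oo)%E)
  (eta : R)
  (heta : decays_with_exponent nrm
     (fun x => P (fine (beta_c P)) [set w | connected_in w 0 x])
     (- d%:R + (2 - eta))) :
  Num.min alpha 1 <= 2 - eta.
Proof.
rewrite leNgt; apply/negP => eta_lt.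
set m := Num.min alpha 1 in eta_lt; set e := 2 - eta in eta_lt heta.
have [m_alpha m1] : m <= alpha /\ m <= 1 by rewrite /m !ge_min !lexx orbT.
have m0 : 0 < m by rewrite lt_min halpha0 ltr01.
(* The exponent [e] may be negative, whereas the dyadic estimate requires s > 0. *)
pose e0 := Num.max e 0.
have [ee0 e00] : e <= e0 /\ 0 <= e0 by rewrite /e0 !le_max !lexx orbT.
have e0m : e0 < m by rewrite gt_max eta_lt.
have d1 : 1 <= d%:R :> R by rewrite ler1n.
(* The two points that cut [e0, m] into thirds, so that e0 < s < a < m. *)
pose s := (2 * e0 + m) / 3; pose a := (e0 + 2 * m) / 3.
have [es s0 sa a_alpha a1] : [/\ e < s, 0 < s, s < a, a <= alpha & a < 1].
  by rewrite /s /a; split; lra.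
have a0 : 0 < a by exact: lt_trans sa.
have sd : s <= d%:R by lra.
set bc := fine (beta_c P) in heta.
have bc0 : 0 <= bc by exact: fine_beta_c_ge0.
pose tau x := Pr (P bc) [set w : config d | connected_in w 0 x].
have tau01 x : 0 <= tau x <= 1.
  by rewrite Pr_ge0 Pr_le1 //; exact: measurable_connected_in.
have [C1 hC1] := hJdecay.
have [Ck Ck0 hCk] := kernel_tail hd hnrm a0 a_alpha hC1.
have [Ct Ct0 hCt] := two_point_le hd hnrm es sd
  (fun x => proj2 (andP (tau01 x))) heta.
have [Kt Kt0 hKt] := sum_two_point_le tau01 s0 sd Ct0 hCt.
have [Ka Ka0 hKa] := sum_powR_le a0 a1.
(* Replacing connections inside the box by unrestricted ones gives weights [tau u] that do not
   depend on [n], so that the radii can be summed. *)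
have box_ge1 n : 1 <= \sum_(u <- box d n) tau u * (bc * (Ck * (n.+1 - sup_norm u)%:R `^ (- a))).
  have out u (F : {fset site d}) uS hF := hCk n u F uS hF.
  apply: le_trans (critical_sum_ge1 hJ hP hbeta_c _ out) _.
    by rewrite mem_box; apply/sup_norm_leP => i; rewrite mxE.
  apply: ler_sum => u _; apply: ler_wpM2r.
    by rewrite mulr_ge0 // mulr_ge0 // powR_ge0.
  apply: le_Pr; [exact: measurable_conn|exact: measurable_connected_in|].
  by move=> w; exact: conn_connected_in.
have boxW n N (G : site d -> R) : (n <= N)%N ->
    \sum_(u <- box d n) G u = \sum_(u <- box d N | (sup_norm u <= n)%N) G u.
  move=> nN; rewrite -[RHS]big_filter; apply/perm_big/uniq_perm.
  - exact: fset_uniq.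
  - by rewrite filter_uniq // fset_uniq.
  move=> u; rewrite mem_filter !mem_box.
  by case: leqP => //= /leq_trans; move/(_ _ nN).
(* Summing over all boxes of radius [n < 2 ^ j] averages the distance of [u] to the
   boundary, so no estimate on spheres is needed. *)
have summed j : 2 ^+ j <= bc * Ck * Kt * Ka * (2 `^ s * 2 `^ (1 - a)) ^+ j.
  pose N := (2 ^ j)%N; pose H := \sum_(0 <= k < N) k.+1%:R `^ (- a) : R.
  have H0 : 0 <= H by apply: sumr_ge0 => k _; exact: powR_ge0.
  apply: (@le_trans _ _ (\sum_(0 <= n < N) \sum_(u <- box d N | (sup_norm u <= n)%N)
      tau u * (bc * (Ck * (n.+1 - sup_norm u)%:R `^ (- a))))).
    rewrite -natrX -[leLHS]mulr1 mulr_natl -[N in _ *+ N]subn0 -sumr_const_nat.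
    rewrite big_nat [leRHS]big_nat; apply: ler_sum => n /andP[_ /ltnW nN].
    by rewrite -boxW.
  apply: (@le_trans _ _ (\sum_(u <- box d N) tau u * (bc * Ck * H))).
    under eq_bigr do rewrite big_mkcond.
    rewrite exchange_big; apply: ler_sum => u _ /=.
    rewrite -big_mkcond -mulr_sumr ler_wpM2l //; first by have /andP[] := tau01 u.
    rewrite -mulr_sumr -mulr_sumr mulrA ler_wpM2l ?mulr_ge0 //.
    exact: sum_powR_shift_le.
  rewrite -mulr_suml exprMn.
  have -> : bc * Ck * Kt * Ka * ((2 `^ s) ^+ j * (2 `^ (1 - a)) ^+ j) =
    Kt * (2 `^ s) ^+ j * (bc * Ck * (Ka * (2 `^ (1 - a)) ^+ j)) by ring.
  apply: ler_pM.
  - by apply: sumr_ge0 => u _; have /andP[] := tau01 u.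
  - by rewrite !mulr_ge0.
  - exact: hKt.
  - by apply: ler_wpM2l; [exact: mulr_ge0|exact: hKa].
(* Dividing [summed] by its geometric factor would keep (2^(a - s))^j bounded in [j], although a >
   s. *)
have as0 : 0 < a - s by rewrite subr_gt0.
have [j] := exprn_unbounded (bc * Ck * Kt * Ka) (powR2_gt1 as0).
apply/negP; rewrite -leNgt.
have q0 : 0 < (2 `^ s * 2 `^ (1 - a)) ^+ j by rewrite exprn_gt0 // mulr_gt0 // powR_gt0.
rewrite -(ler_pM2r q0) -exprMn; apply: le_trans (summed j).
rewrite -!powRD ?pnatr_eq0 ?implybT //.
by rewrite (_ : a - s + (s + (1 - a)) = 1) ?powRr1 //; ring.
Qed.
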